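(* Let $M$ be an $F$-manifold with product $\circ$ given by the $(1,2)$-tensor field $c$, endowed with a torsionless (not necessarily flat) connection $\nabla$ satisfying $(\nabla_Xc)(Y,Z)=(\nabla_Yc)(X,Z)$ for all vector fields $X,Y,Z$, and let $R$ be the curvature of $\nabla$. If $X$ is a vector field such that $$(\nabla_Z X)\circ W=(\nabla_W X)\circ Z$$ for all pairs $(Z,W)$ of vector fields, then the identity $$Z\circ R(W,Y)(X)+W\circ R(Y,Z)(X)+Y\circ R(Z,W)(X)=0$$ holds for any choice of the vector fields $(Y,W,Z)$.
   Context: An $F$-manifold is a smooth manifold endowed with a commutative associative product on vector fields $(X\circ Y)^i=c^i_{jk}X^jY^k$ given by a $(1,2)$-tensor field $c$ satisfying the Hertling–Manin condition: for all vector fields $X,Y,Z,W$, $$[X\circ Y,Z\circ W]-[X\circ Y,Z]\circ W-[X\circ Y,W]\circ Z-X\circ[Y,Z\circ W]+X\circ[Y,Z]\circ W+X\circ[Y,W]\circ Z-Y\circ[X,Z\circ W]+Y\circ[X,Z]\circ W+Y\circ[X,W]\circ Z=0 .$$ No unit is assumed. The curvature is $R(X,Y)(Z)=\nabla_X\nabla_YZ-\nabla_Y\nabla_XZ-\nabla_{[X,Y]}Z$. *)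

(* Defs.v *)
From HB Require Import structures.
From mathcomp Require Import all_boot all_order all_algebra.
From mathcomp Require Import sesquilinear ring.
From mathcomp Require Import all_classical all_reals all_analysis.

Set Implicit Arguments.
Unset Strict Implicit.
Unset Printing Implicit Defensive.

Import Order.TTheory GRing.Theory Num.Theory.
Import numFieldNormedType.Exports.

Local Open Scope classical_set_scope.
Local Open Scope ring_scope.

Lemma near_eq_continuous (T U : topologicalType) (f g : T -> U) (x : T) :
  (\forall y \near x, f y = g y) ->
  {for x, continuous f} -> {for x, continuous g}.
Proof.
move=> fg; rewrite /prop_for /continuous_at -(nbhs_singleton fg) => fc.
by apply: cvg_trans fc; exact: near_eq_cvg.
Qed.

Section SmoothEuclidean.
Variables (R : realType) (n : nat).

(* Class C^k on an open set U: f and all its iterated partial derivatives up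
   to order k exist and are continuous at the points of U.  The values of f
   outside U are irrelevant (see Ck_ext). *)
Fixpoint Ck (V : normedModType R) (U : set 'rV[R]_n) (k : nat)
    (f : 'rV[R]_n -> V) : Prop :=
  (forall x, U x -> {for x, continuous f}) /\
  if k is k'.+1 then
    forall i : 'I_n,
      (forall x, U x -> derivable f x (delta_mx 0 i)) /\
      Ck U k' (fun x => 'D_(delta_mx 0 i) f x)
  else True.

Definition smooth_on (V : normedModType R) (U : set 'rV[R]_n)
  (f : 'rV[R]_n -> V) : Prop := forall k, Ck U k f.

Lemma CkW (V : normedModType R) (U : set 'rV[R]_n) k (f : 'rV[R]_n -> V) :
  Ck U k.+1 f -> Ck U k f.
Proof.
elim: k f => [|k IH] f [fc fD]; first by split.
by split => // i; have [df Df] := fD i; split => //; exact: IH.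
Qed.

Lemma Ck_ext (V : normedModType R) (U : set 'rV[R]_n) k (f g : 'rV[R]_n -> V) :
  open U -> (forall x, U x -> f x = g x) -> Ck U k f -> Ck U k g.
Proof.
move=> oU; elim: k f g => [|k IH] f g fg [fc fD].
  split=> // x Ux; apply: (near_eq_continuous _ (fc x Ux)).
  exact: filterS fg (open_nbhs_nbhs (conj oU Ux)).
have near_fg (x : 'rV[R]_n) : U x -> \forall y \near x, f y = g y.
  by move=> Ux; exact: filterS fg (open_nbhs_nbhs (conj oU Ux)).
split=> [x Ux|i]; first exact: near_eq_continuous (near_fg x Ux) (fc x Ux).
have [df Df] := fD i; split=> [x Ux|].
  exact: near_eq_derivable (near_fg x Ux) (df x Ux).
by apply: (IH _ _ _ Df) => x Ux; exact: near_eq_derive (near_fg x Ux).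
Qed.

Lemma Ck_cst (V : normedModType R) (U : set 'rV[R]_n) k (a : V) :
  Ck U k (fun=> a).
Proof.
elim: k a => [|k IH] a; (split; last by []) || split.
- by move=> x _; exact: cst_continuous.
- by move=> x _; exact: cst_continuous.
move=> i; split; first by move=> x _; exact: derivable_cst.
rewrite [F in Ck _ _ F](_ : _ = fun=> 0); first exact: IH.
by apply/funext => x; rewrite derive_cst.
Qed.

Lemma CkD (V : normedModType R) (U : set 'rV[R]_n) k (f g : 'rV[R]_n -> V) :
  open U -> Ck U k f -> Ck U k g -> Ck U k (f + g).
Proof.
move=> oU; elim: k f g => [|k IH] f g [fc fD] [gc gD]; (split; last by []) || split.
- by move=> x Ux; apply: continuousD; [exact: fc|exact: gc].
- by move=> x Ux; apply: continuousD; [exact: fc|exact: gc].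
move=> i; have [df Df] := fD i; have [dg Dg] := gD i; split.
  by move=> x Ux; apply: derivableD; [exact: df|exact: dg].
apply: Ck_ext oU _ (IH _ _ Df Dg) => x Ux.
by rewrite deriveD //; [exact: df|exact: dg].
Qed.

Lemma CkM (U : set 'rV[R]_n) k (f g : 'rV[R]_n -> R) :
  open U -> Ck U k f -> Ck U k g -> Ck U k (f * g).
Proof.
move=> oU; elim: k f g => [|k IH] f g fk gk.
  by split => // x Ux; apply: continuousM; [exact: fk.1|exact: gk.1].
have [fc fD] := fk; have [gc gD] := gk; split.
  by move=> x Ux; apply: continuousM; [exact: fc|exact: gc].
move=> i; have [df Df] := fD i; have [dg Dg] := gD i; split.
  by move=> x Ux; apply: derivableM; [exact: df|exact: dg].
apply: Ck_ext oU _
  (CkD oU (IH _ _ (CkW fk) Dg) (IH _ _ (CkW gk) Df)) => x Ux.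
by rewrite deriveM //; [exact: df|exact: dg].
Qed.

End SmoothEuclidean.

Section Manifold.
Variables (R : realType) (n : nat).

(* A homeomorphism from the open set dom onto an open subset of R^n; param is
   the inverse map, both maps being junk-extended to total functions. *)
Record chart (M : topologicalType) := Chart {
  dom : set M;
  coord : M -> 'rV[R]_n;
  param : 'rV[R]_n -> M;
  open_dom : open dom;
  open_codom : open (coord @` dom);
  coordK : forall p, dom p -> param (coord p) = p;
  coord_continuous : forall p, dom p -> {for p, continuous coord};
  param_continuous :
    forall x, (coord @` dom) x -> {for x, continuous param}
}.

(* The atlas need not be maximal: it determines a unique maximal one, and the
   notions below depend only on the latter. *)
Record smoothManifold := SmoothManifold {
  carrier :> topologicalType;
  manifold_hausdorff : hausdorff_space carrier;
  manifold_second_countable : @second_countable carrier;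
  atlas : set (chart carrier);
  atlas_cover : forall p, exists2 k, atlas k & dom k p;
  atlas_compat : forall k l, atlas k -> atlas l ->
    smooth_on (coord k @` (dom k `&` dom l)) (coord l \o param k)
}.

Definition smooth (M : smoothManifold) (f : M -> R) : Prop :=
  forall k, atlas k -> smooth_on (coord k @` dom k) (f \o param k).

Definition smooth_pred (M : smoothManifold) : {pred M -> R} :=
  fun f => `[< smooth f >].

End Manifold.

Section SmoothFunctions.
Variables (R : realType) (n : nat) (M : smoothManifold R n).

Lemma smooth_cst (a : R) : smooth (fun _ : M => a).
Proof. by move=> k _ j; exact: Ck_cst. Qed.

Lemma smoothD (f g : M -> R) : smooth f -> smooth g -> smooth (f + g).
Proof.
move=> sf sg k ak j.
exact (CkD (@open_codom _ _ _ k) (sf k ak j) (sg k ak j)).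
Qed.

Lemma smoothM (f g : M -> R) : smooth f -> smooth g -> smooth (f * g).
Proof.
move=> sf sg k ak j.
exact (CkM (@open_codom _ _ _ k) (sf k ak j) (sg k ak j)).
Qed.

Lemma smoothZ (a : R) (f : M -> R) : smooth f -> smooth (a *: f).
Proof. by move=> sf; apply: (smoothM (smooth_cst a) sf). Qed.

Lemma smoothB (f g : M -> R) : smooth f -> smooth g -> smooth (f - g).
Proof.
by move=> sf sg; rewrite -scaleN1r; apply: smoothD => //; exact: smoothZ.
Qed.

Fact smooth_subring_closed : subring_closed (@smooth_pred R n M).
Proof.
split=> [|f g /asboolP sf /asboolP sg|f g /asboolP sf /asboolP sg];
  apply/asboolP.
- exact: smooth_cst.
- exact: smoothB.
- exact: smoothM.
Qed.

Fact smooth_submod_closed : submod_closed (@smooth_pred R n M).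
Proof.
split=> [|a f g /asboolP sf /asboolP sg]; apply/asboolP.
- exact: smooth_cst.
- by apply: smoothD => //; exact: smoothZ.
Qed.

HB.instance Definition _ :=
  GRing.isSubringClosed.Build (M -> R) (@smooth_pred R n M)
    smooth_subring_closed.
HB.instance Definition _ :=
  GRing.isSubmodClosed.Build R (M -> R) (@smooth_pred R n M)
    smooth_submod_closed.

(* The R-algebra C^oo(M). *)
Record smoothFun := SmoothFun {
  smooth_val :> M -> R;
  _ : smooth_val \in @smooth_pred R n M
}.

HB.instance Definition _ := [isSub for smooth_val].
HB.instance Definition _ := [Choice of smoothFun by <:].
HB.instance Definition _ :=
  GRing.SubChoice_isSubComPzRing.Build (M -> R) (@smooth_pred R n M) smoothFun
    smooth_subring_closed.
HB.instance Definition _ :=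
  GRing.SubZmodule_isSubLmodule.Build R (M -> R) (@smooth_pred R n M) smoothFun
    smooth_submod_closed.

Lemma smooth_valP (f : smoothFun) : smooth f.
Proof. by case: f => f /= /asboolP. Qed.

Definition mkSmooth (f : M -> R) (sf : smooth f) : smoothFun :=
  SmoothFun (asboolT sf).

Lemma smoothFun_ext (f g : smoothFun) : f =1 g -> f = g.
Proof. by move=> fg; apply: val_inj; apply/funext. Qed.

End SmoothFunctions.

Section TangentSpace.
Variables (R : realType) (n : nat) (M : smoothManifold R n).
Local Notation C := (smoothFun M).

Definition derivation_at (p : M) : {pred C -> R} :=
  fun v => `[< (forall (a : R) (f g : C), v (a *: f + g) = a * v f + v g) /\
               (forall f g : C, v (f * g) = f p * v g + g p * v f) >].

Fact derivation_submod_closed (p : M) : submod_closed (derivation_at p).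
Proof.
split=> [|a u v /asboolP [ul uL] /asboolP [vl vL]]; apply/asboolP.
  by split=> [a f g|f g]; rewrite !mulr0 addr0.
split=> [b f g|f g].
  by rewrite /= -![(_ + _) _]/(_ + _) -![(_ *: _) _]/(_ * _) ul vl; ring.
by rewrite /= -![(_ + _) _]/(_ + _) -![(_ *: _) _]/(_ * _) uL vL; ring.
Qed.

HB.instance Definition _ (p : M) :=
  GRing.isSubmodClosed.Build R (C -> R) (derivation_at p)
    (derivation_submod_closed p).

(* T_p M, the real vector space of derivations of C^oo(M) at p.  M being
   Hausdorff and second countable, bump functions make global functions
   interchangeable with germs at p. *)
Record tangent (p : M) := Tangent {
  tangent_val :> C -> R;
  _ : tangent_val \in derivation_at p
}.

HB.instance Definition _ p := [isSub for @tangent_val p].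
HB.instance Definition _ p := [Choice of tangent p by <:].
HB.instance Definition _ p :=
  GRing.SubChoice_isSubLmodule.Build R (C -> R) (derivation_at p) (tangent p)
    (derivation_submod_closed p).

Lemma tangent_ext p (u v : tangent p) : u =1 v -> u = v.
Proof. by move=> uv; apply: val_inj; apply/funext. Qed.

Lemma tangent_linear p (v : tangent p) (a : R) (f g : C) :
  v (a *: f + g) = a * v f + v g.
Proof. by case: v => v /= /asboolP [-> _]. Qed.

Lemma tangentM p (v : tangent p) (f g : C) :
  v (f * g) = f p * v g + g p * v f.
Proof. by case: v => v /= /asboolP [_ ->]. Qed.

End TangentSpace.

Section VectorFields.
Variables (R : realType) (n : nat) (M : smoothManifold R n).
Local Notation C := (smoothFun M).

(* A section of the tangent bundle is smooth iff it maps smooth functions to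
   smooth functions, equivalently iff its components in charts are smooth. *)
Record vectorField := VectorField {
  vf_val :> forall p : M, tangent p;
  vf_smooth : forall f : C, smooth (fun p => vf_val p f)
}.

Implicit Types (X Y Z : vectorField) (f g : C).

Lemma vf_ext X Y : (forall p f, X p f = Y p f) -> X = Y.
Proof.
case: X Y => [x sx] [y sy] /= xy.
have {xy} xy : x = y.
  by apply: functional_extensionality_dep => p; exact: tangent_ext.
by case: y / xy sy => sy; congr VectorField; exact: Prop_irrelevance.
Qed.

(* The function Xf. *)
Definition vf_app X f : C := mkSmooth (vf_smooth X f).

HB.instance Definition _ := gen_eqMixin vectorField.
HB.instance Definition _ := gen_choiceMixin vectorField.

Definition vf0 : vectorField :=
  @VectorField (fun p => 0) (fun f => smooth_cst 0).

Definition vfN X : vectorField :=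
  @VectorField (fun p => - X p)
    (fun f => smooth_valP (- vf_app X f)).

Definition vfD X Y : vectorField :=
  @VectorField (fun p => X p + Y p)
    (fun f => smooth_valP (vf_app X f + vf_app Y f)).

Definition vfZ f X : vectorField :=
  @VectorField (fun p => f p *: X p)
    (fun g => smooth_valP (f * vf_app X g)).

Fact vfDA : associative vfD.
Proof. by move=> X Y Z; apply: vf_ext => p f; rewrite /= addrA. Qed.
Fact vfDC : commutative vfD.
Proof. by move=> X Y; apply: vf_ext => p f; rewrite /= addrC. Qed.
Fact vf0D : left_id vf0 vfD.
Proof. by move=> X; apply: vf_ext => p f; rewrite /= add0r. Qed.
Fact vfND : left_inverse vf0 vfN vfD.
Proof. by move=> X; apply: vf_ext => p f; rewrite /= addNr. Qed.

HB.instance Definition _ :=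
  GRing.isZmodule.Build vectorField vfDA vfDC vf0D vfND.

Fact vfZA f g X : vfZ f (vfZ g X) = vfZ (f * g) X.
Proof. by apply: vf_ext => p h; rewrite /= scalerA. Qed.
Fact vf1Z : left_id 1 vfZ.
Proof. by move=> X; apply: vf_ext => p h; rewrite /= scale1r. Qed.
Fact vfZDr : right_distributive vfZ +%R.
Proof. by move=> f X Y; apply: vf_ext => p h; rewrite /= scalerDr. Qed.
Fact vfZDl X : {morph vfZ^~ X : f g / f + g}.
Proof. by move=> f g; apply: vf_ext => p h; rewrite /= scalerDl. Qed.

(* Vector fields form a module over the ring C^oo(M). *)
HB.instance Definition _ :=
  GRing.Zmodule_isLmodule.Build C vectorField vfZA vf1Z vfZDr vfZDl.

Fact bracket_derivation X Y (p : M) :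
  (fun f => X p (vf_app Y f) - Y p (vf_app X f)) \in derivation_at p.
Proof.
have appL Z (a : R) f g : vf_app Z (a *: f + g) = a *: vf_app Z f + vf_app Z g.
  by apply: smoothFun_ext => q; exact: tangent_linear.
have appM Z f g : vf_app Z (f * g) = f * vf_app Z g + g * vf_app Z f.
  by apply: smoothFun_ext => q; exact: tangentM.
have tD (v : tangent p) f g : v (f + g) = v f + v g.
  by rewrite -[f]scale1r tangent_linear mul1r scale1r.
apply/asboolP; split=> [a f g|f g].
  by rewrite !appL !tangent_linear; ring.
rewrite !appM !tD !tangentM /=; ring.
Qed.

Definition bracket X Y : vectorField :=
  @VectorField (fun p => Tangent (bracket_derivation X Y p))
    (fun f => smooth_valP
       (vf_app X (vf_app Y f) - vf_app Y (vf_app X f))).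

End VectorFields.

Notation "[[ X , Y ]]" := (bracket X Y)
  (at level 0, X at level 99, Y at level 99, format "[[ X ,  Y ]]") : ring_scope.

Section Tensors.
Variables (R : realType) (n : nat) (M : smoothManifold R n).
Local Notation V := (vectorField M).

(* A (1,2)-tensor field: a smooth family of bilinear maps on the tangent
   spaces; smoothness is tested on smooth vector fields. *)
Record tensorField12 := TensorField12 {
  tensor_val :> forall p : M,
    {bilinear tangent p -> tangent p -> tangent p};
  tensor_smooth : forall (X Y : V) (f : smoothFun M),
    smooth (fun p => tensor_val p (X p) (Y p) f)
}.

Definition tensor_app (c : tensorField12) (X Y : V) : V :=
  @VectorField _ _ M (fun p => c p (X p) (Y p)) (tensor_smooth c X Y).

(* R-linearity in the second argument follows from the last two axioms, a
   constant being a smooth function with zero derivative. *)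
Record connection := Connection {
  nabla :> V -> V -> V;
  nabla_linear : forall (f : smoothFun M) (X X' Y : V),
    nabla (f *: X + X') Y = f *: nabla X Y + nabla X' Y;
  nabla_additive : forall X Y Y' : V,
    nabla X (Y + Y') = nabla X Y + nabla X Y';
  nabla_leibniz : forall (X : V) (f : smoothFun M) (Y : V),
    nabla X (f *: Y) = vf_app X f *: Y + f *: nabla X Y
}.

Definition torsionless (D : connection) : Prop :=
  forall X Y : V, D X Y - D Y X = [[X, Y]].

(* R(X,Y)(Z) *)
Definition curvature (D : connection) (X Y Z : V) : V :=
  D X (D Y Z) - D Y (D X Z) - D [[X, Y]] Z.

(* (nabla_X c)(Y,Z) *)
Definition nabla_tensor (D : connection) (c : tensorField12) (X Y Z : V) : V :=
  D X (tensor_app c Y Z) - tensor_app c (D X Y) Z - tensor_app c Y (D X Z).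

Definition hertling_manin (c : tensorField12) : Prop :=
  let m := tensor_app c in
  forall X Y Z W : V,
    [[m X Y, m Z W]] - m [[m X Y, Z]] W - m [[m X Y, W]] Z
    - m X [[Y, m Z W]] + m (m X [[Y, Z]]) W + m (m X [[Y, W]]) Z
    - m Y [[X, m Z W]] + m (m Y [[X, Z]]) W + m (m Y [[X, W]]) Z = 0.

End Tensors.

Record FManifold (R : realType) (n : nat) := mkFManifold {
  fm_manifold :> smoothManifold R n;
  fm_tensor : tensorField12 fm_manifold;
  fm_comm : commutative (tensor_app fm_tensor);
  fm_assoc : associative (tensor_app fm_tensor);
  fm_hertling_manin : hertling_manin fm_tensor
}.

Definition fm_mul (R : realType) (n : nat) (M : FManifold R n)
  (X Y : vectorField M) : vectorField M := tensor_app (fm_tensor M) X Y.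

Notation "X \o_F Y" := (fm_mul X Y)
  (at level 40, left associativity, format "X  \o_F  Y") : ring_scope.

(* Main.v *)
Require Import Defs.
From mathcomp Require Import all_boot all_order all_algebra.
From mathcomp Require Import all_classical all_reals all_analysis.

Import GRing.Theory.
Local Open Scope ring_scope.

(** Write [H(Y, Z) = D_Y D_Z X - D_(D_Y Z) X] for the second covariant
    derivative of [X].  As [D] has no torsion, the Ricci identity gives
    [R(Y, Z) X = H(Y, Z) - H(Z, Y)] ([curvature_hessian]).

    The tensor [T(Y, Z, W) = (D_Y c)(Z, W)] is totally symmetric: in [Y, Z] by
    hypothesis and in [Z, W] because the product is commutative.  Differentiating
    [(D_Z X) o W = (D_W X) o Z] along [Y] shows that
    [H(Y, Z) o W + T(Y, D_Z X, W)] is symmetric in [Z, W]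
    ([hessian_mul_sym]).  The symmetry of [T] makes the same true of
    [q(Y; Z, W) = H(Y, Z) o W + T(Y, D_Z X, W) + T(Z, D_Y X, W)],
    in which the two terms in [T] are exchanged by [Y <-> Z].  They therefore
    drop out of a curvature term:
    [R(Y, Z) X o W = q(Y; Z, W) - q(Z; Y, W)].
    By the symmetry of [q] in its last two arguments, this difference is
    [q_Y - q_Z], where [q_Y] is the value of [q] with [Y] in the first place and
    the other two fields in any order, and the cyclic sum telescopes:
    [(q_Y - q_Z) + (q_Z - q_W) + (q_W - q_Y) = 0]. *)

Lemma nablaBl (R : realType) (n : nat) (M : smoothManifold R n)
    (D : connection M) (X Y Z : vectorField M) :
  D (X - Y) Z = D X Z - D Y Z.
Proof. by rewrite addrC -scaleN1r nabla_linear scaleN1r addrC. Qed.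

Lemma fm_mulBl (R : realType) (n : nat) (M : FManifold R n)
    (X Y Z : vectorField M) : (X - Y) \o_F Z = X \o_F Z - Y \o_F Z.
Proof. by apply: vf_ext => p f; rewrite /= linearBl. Qed.

Lemma fm_mulC {R : realType} {n : nat} {M : FManifold R n}
    (X Y : vectorField M) : X \o_F Y = Y \o_F X.
Proof. exact: fm_comm. Qed.

Section Hessian.
Context {R : realType} {n : nat} {M : FManifold R n}.
Context (D : connection M) (X : vectorField M).
Local Notation T := (nabla_tensor D (fm_tensor M)).

Definition hessian (Y Z : vectorField M) : vectorField M :=
  D Y (D Z X) - D (D Y Z) X.

Lemma curvature_hessian (Y Z : vectorField M) :
  torsionless D -> curvature D Y Z X = hessian Y Z - hessian Z Y.
Proof.
by move=> tD; rewrite /curvature -tD nablaBl opprD addrACA -opprD.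
Qed.

Lemma nabla_tensorE (Y Z W : vectorField M) :
  T Y Z W = D Y (Z \o_F W) - D Y Z \o_F W - Z \o_F D Y W.
Proof. by []. Qed.

Lemma nabla_tensorC (Y Z W : vectorField M) : T Y Z W = T Y W Z.
Proof.
by rewrite !nabla_tensorE fm_mulC (fm_mulC (D Y Z)) (fm_mulC Z) addrAC.
Qed.

(** The Leibniz rule turns the left side into
    [D_Y (D_Z X o W) - D_(D_Y Z) X o W - D_Z X o D_Y W]; the hypothesis on [X]
    makes the first term symmetric in [Z, W], and replaces the second by
    [D_W X o D_Y Z], the mirror image of the third. *)
Lemma hessian_mul_sym (Y Z W : vectorField M) :
  (forall Z W : vectorField M, D Z X \o_F W = D W X \o_F Z) ->
  hessian Y Z \o_F W + T Y (D Z X) W = hessian Y W \o_F Z + T Y (D W X) Z.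
Proof.
move=> hX.
have expand (U V : vectorField M) : hessian Y U \o_F V + T Y (D U X) V =
    D Y (D U X \o_F V) - D U X \o_F D Y V - D V X \o_F D Y U.
  rewrite fm_mulBl (hX (D Y U)) nabla_tensorE addrC.
  by rewrite [_ - _ - D U X \o_F _]addrAC addrA subrK.
by rewrite !expand (hX W Z) addrAC.
Qed.

(** The symmetrised form [q] of the argument: adding [T(Z, D_Y X, W)] keeps the
    symmetry in [Z, W] and makes the correction to [H(Y, Z) o W] symmetric in
    [Y, Z] as well. *)
Definition corrected_hessian (Y Z W : vectorField M) : vectorField M :=
  hessian Y Z \o_F W + T Y (D Z X) W + T Z (D Y X) W.

Lemma corrected_hessian_sym (Y Z W : vectorField M) :
  (forall Y Z W : vectorField M, T Y Z W = T Z Y W) ->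
  (forall Z W : vectorField M, D Z X \o_F W = D W X \o_F Z) ->
  corrected_hessian Y Z W = corrected_hessian Y W Z.
Proof.
move=> hT hX; rewrite /corrected_hessian hessian_mul_sym //.
by congr (_ + _); rewrite nabla_tensorC hT nabla_tensorC.
Qed.

Lemma mul_curvature (Y Z W : vectorField M) :
  torsionless D ->
  W \o_F curvature D Y Z X = corrected_hessian Y Z W - corrected_hessian Z Y W.
Proof.
move=> tD; rewrite fm_mulC curvature_hessian // fm_mulBl.
rewrite /corrected_hessian (addrAC (hessian Z Y \o_F W)).
by do 2!rewrite opprD addrACA subrr addr0.
Qed.

End Hessian.

Theorem proposition16 (R : realType) (n : nat) (M : FManifold R n)
    (D : connection M) (X : vectorField M) :
  torsionless D ->
  (forall Y Z W : vectorField M,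
     nabla_tensor D (fm_tensor M) Y Z W = nabla_tensor D (fm_tensor M) Z Y W) ->
  (forall Z W : vectorField M, D Z X \o_F W = D W X \o_F Z) ->
  forall Y W Z : vectorField M,
    Z \o_F curvature D W Y X + W \o_F curvature D Y Z X
      + Y \o_F curvature D Z W X = 0.
Proof.
move=> tD hT hX Y W Z; rewrite !mul_curvature //.
have qC := corrected_hessian_sym D X _ _ _ hT hX.
by rewrite (qC W Z) (qC Y W) (qC Z Y) !subrKA subrr.
Qed.
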